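(* Let $P\in C^{2,\alpha}(a,b)$, $Q\in C^{1,\alpha}(a,b)$, and let $R:(a,b)\to\mathbb{R}$ be $F$-continuous. The second $\alpha$-order fractal differential equation $$P(x)D_x^{2\alpha}f(x)+Q(x)D_x^{\alpha}f(x)+R(x)f(x)=0$$ is exact if $$D_x^{2\alpha}P(x)-D_x^{\alpha}Q(x)+R(x)=0\qquad\text{for all }x\in F\cap(a,b).$$
   Context: Let $0<\alpha\le 1$, $F\subset\mathbb{R}$, and $(a,b)$ an open interval. For an interval $I$ put $\rho(F,I)=1$ if $F\cap I\ne\emptyset$ and $0$ otherwise. For $u<v$ and $\delta>0$ let $\gamma^\alpha_\delta(F,u,v)=\inf\sum_{i=0}^{n-1}\Gamma(\alpha+1)(t_{i+1}-t_i)^\alpha\rho(F,[t_i,t_{i+1}])$, the infimum over subdivisions $u=t_0<\dots<t_n=v$ with $\max_i(t_{i+1}-t_i)\le\delta$; $\gamma^\alpha(F,u,v)=\lim_{\delta\to0}\gamma^\alpha_\delta(F,u,v)$ (and $\gamma^\alpha(F,u,u)=0$). Fix $a_0\in\mathbb{R}$. The integral staircase function is $S_F^\alpha(x)=\gamma^\alpha(F,a_0,x)$ if $x\ge a_0$ and $S_F^\alpha(x)=-\gamma^\alpha(F,x,a_0)$ otherwise. $F$ is $\alpha$-perfect: $S_F^\alpha$ is finite on $\mathbb{R}$, $F$ is closed with no isolated points, and $F$ is exactly the set of points $x$ such that $S_F^\alpha$ is not constant on any open interval containing $x$. For $x\in F$, $\mathrm{F\text{-}lim}_{y\to x}h(y)=\ell$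 means: for every $\varepsilon>0$ there is $\delta>0$ with $|h(y)-\ell|<\varepsilon$ for all $y\in F$ with $0<|y-x|<\delta$. A function $h$ is $F$-continuous in $(a,b)$ if $\mathrm{F\text{-}lim}_{y\to x}h(y)=h(x)$ for all $x\in F\cap(a,b)$. The $F^\alpha$-derivative of $f:(a,b)\to\mathbb{R}$ is $D_x^\alpha f(x)=\mathrm{F\text{-}lim}_{y\to x}\frac{f(y)-f(x)}{S_F^\alpha(y)-S_F^\alpha(x)}$ if $x\in F$ (when the limit exists), and $0$ if $x\notin F$; $D_x^{2\alpha}f=D_x^\alpha(D_x^\alpha f)$. $C^{n,\alpha}(a,b)$ is the set of $f:(a,b)\to\mathbb{R}$ that are $n$ times $F^\alpha$-differentiable at every point of $F\cap(a,b)$. Exactness: the equation $P D_x^{2\alpha}f+Q D_x^{\alpha}f+R f=0$ is called exact if it can be transformed into the form $D_x^\alpha(P(x)D_x^\alpha f(x))+D_x^\alpha(g(x)f(x))=0$ for some function $g$ determined by $P,Q,R$; i.e. there is $g\in C^{1,\alpha}(a,b)$ such that for every $f\in C^{2,\alpha}(a,b)$ and every $x\in F\cap(a,b)$, $P D_x^{2\alpha}f+QD_x^\alpha f+Rf=D_x^\alpha(PD_x^\alpha f)+D_x^\alpha(gf)$. *)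

(* Defs.v *)
From HB Require Import structures.
From mathcomp Require Import all_boot all_order all_algebra.
From mathcomp Require Import all_classical all_reals all_analysis.
Set Implicit Arguments.
Unset Strict Implicit.
Unset Printing Implicit Defensive.
Import Order.TTheory GRing.Theory Num.Theory.
Import numFieldNormedType.Exports.
Local Open Scope classical_set_scope.
Local Open Scope ring_scope.

(* Euler's Gamma function, for s > 0. *)
Definition Gamma (R : realType) (s : R) : R :=
  Rintegral lebesgue_measure `]0, +oo[ (fun t : R => t `^ (s - 1) * expR (- t)).

Definition rho (R : realType) (F I : set R) : R :=
  if `[< F `&` I !=set0 >] then 1 else 0.

(* [itv_partition u v s] says that u :: s is a strictly increasing sequence
   ending at v, so the subdivision points are t_i = node u v s i,
   0 <= i <= n = size s. *)
Definition node (R : realType) (u v : R) (s : seq R) (i : nat) : R :=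
  nth v (u :: s) i.

Definition subdivision (R : realType) (delta u v : R) (s : seq R) : Prop :=
  itv_partition u v s /\
  forall i, (i < size s)%N -> node u v s i.+1 - node u v s i <= delta.

Definition mass_sum (R : realType) (alpha : R) (F : set R) (u v : R)
    (s : seq R) : R :=
  \sum_(0 <= i < size s)
    Gamma (alpha + 1) * (node u v s i.+1 - node u v s i) `^ alpha *
    rho F `[node u v s i, node u v s i.+1].

Definition coarse_mass (R : realType) (alpha : R) (F : set R) (u v : R)
    (delta : R) : \bar R :=
  ereal_inf [set (mass_sum alpha F u v s)%:E | s in subdivision delta u v].

(* [coarse_mass] is nonincreasing in delta, so for u < v the limit exists in
   \bar R, possibly +oo.  Only u <= v is meaningful. *)
Definition mass (R : realType) (alpha : R) (F : set R) (u v : R) : \bar R :=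
  if u < v then lim (coarse_mass alpha F u v delta @[delta --> 0^'+]) else 0%E.

Definition staircase (R : realType) (alpha : R) (F : set R) (a0 x : R) :
    \bar R :=
  if a0 <= x then mass alpha F a0 x else (- mass alpha F x a0)%E.

Definition alpha_perfect (R : realType) (alpha : R) (F : set R) (a0 : R) :
    Prop :=
  [/\ forall x, staircase alpha F a0 x \is a fin_num,
      closed F,
      isolated F = set0 &
      F = [set x | forall c d : R, x \in `]c, d[ ->
        ~ exists k, forall y, y \in `]c, d[ -> staircase alpha F a0 y = k]].

(* For x in F, [h y @[y --> Fnbhs F x] --> l] is F-lim_{y -> x} h(y) = l. *)
Definition Fnbhs (R : realType) (F : set R) (x : R) : set_system R :=
  within F x^'.

(* Functions on an open interval (a, b) are represented by total functions:
   the notions below, at points of (a, b), depend only on the values there. *)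
Definition Fcontinuous (R : realType) (F : set R) (a b : R) (h : R -> R) :
    Prop :=
  forall x, x \in F -> x \in `]a, b[ -> h y @[y --> Fnbhs F x] --> h x.

(* When F is alpha-perfect, the denominator vanishes for at most two points y
   of F other than x, hence for no y in F close enough to x. *)
Definition Fquotient (R : realType) (alpha : R) (F : set R) (a0 : R)
    (f : R -> R) (x y : R) : R :=
  (f y - f x) /
  (fine (staircase alpha F a0 y) - fine (staircase alpha F a0 x)).

Definition Fderivable (R : realType) (alpha : R) (F : set R) (a0 : R)
    (f : R -> R) (x : R) : Prop :=
  cvg (Fquotient alpha F a0 f x y @[y --> Fnbhs F x]).

(* At points of F where [Fderivable] fails the value is unspecified. *)
Definition Fderive (R : realType) (alpha : R) (F : set R) (a0 : R)
    (f : R -> R) (x : R) : R :=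
  if x \in F then lim (Fquotient alpha F a0 f x y @[y --> Fnbhs F x]) else 0.

Definition Fderiven (R : realType) (alpha : R) (F : set R) (a0 : R) (n : nat)
    (f : R -> R) : R -> R :=
  iter n (Fderive alpha F a0) f.

Definition Cn (R : realType) (alpha : R) (F : set R) (a0 a b : R) (n : nat)
    (f : R -> R) : Prop :=
  forall k, (k < n)%N -> forall x, x \in F -> x \in `]a, b[ ->
    Fderivable alpha F a0 (Fderiven alpha F a0 k f) x.

(* P D^2 f + Q D f + T f = 0 is exact on (a, b).  The derivatives on the
   right-hand side exist, for F alpha-perfect, as soon as P and g are in C^1
   and f is in C^2. *)
Definition exact_equation (R : realType) (alpha : R) (F : set R) (a0 a b : R)
    (P Q T : R -> R) : Prop :=
  exists g : R -> R, Cn alpha F a0 a b 1 g /\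
    forall f : R -> R, Cn alpha F a0 a b 2 f ->
    forall x, x \in F -> x \in `]a, b[ ->
      P x * Fderiven alpha F a0 2 f x + Q x * Fderive alpha F a0 f x + T x * f x =
      Fderive alpha F a0 (fun y => P y * Fderive alpha F a0 f y) x +
      Fderive alpha F a0 (fun y => g y * f y) x.

(* Main.v *)
Require Import Defs.
From mathcomp Require Import all_boot all_order all_algebra.
From mathcomp Require Import all_classical all_reals all_analysis.
From mathcomp Require Import ring lra.
Import Order.TTheory GRing.Theory Num.Theory.
Import numFieldNormedType.Exports.
Local Open Scope classical_set_scope.
Local Open Scope ring_scope.

(* Take [g = Q - D P]: by the product rule
   [D (P D f) + D (g f) = P D^2 f + Q D f + (D Q - D^2 P) f].  The product rule
   needs F-differentiable functions to be F-continuous, hence the staircase to be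
   continuous and to differ from its value at [x] at all nearby points of [F].
   Both follow from the additivity of the mass. *)

(** * The cost of a single cell *)

Lemma Gamma_ge0 (R : realType) (s : R) : 0 <= Gamma s.
Proof. by apply: Rintegral_ge0 => t _; rewrite mulr_ge0 ?powR_ge0 ?expR_ge0. Qed.

(** One summand of [mass_sum], isolated so that sums can be treated cell by cell. *)
Definition cell_mass {R : realType} (alpha : R) (F : set R) (u v : R) : R :=
  Gamma (alpha + 1) * (v - u) `^ alpha * rho F `[u, v].

Section CellMass.
Context {R : realType} (alpha : R) (F : set R).
Hypothesis alpha_gt0 : 0 < alpha.

Let rho_ge0 I : 0 <= rho F I.
Proof. by rewrite /rho; case: ifP. Qed.

Let rho_le1 I : rho F I <= 1.
Proof. by rewrite /rho; case: ifP. Qed.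

Let rhoS I J : I `<=` J -> rho F I <= rho F J.
Proof.
move=> IJ; rewrite /rho; case: asboolP => [[z [Fz Iz]]|_]; last by case: ifP.
by case: asboolP => // -[]; exists z; split => //; exact: IJ.
Qed.

Lemma cell_mass_ge0 u v : 0 <= cell_mass alpha F u v.
Proof. by rewrite !mulr_ge0 ?powR_ge0 ?Gamma_ge0. Qed.

Lemma cell_mass_le (d u v : R) : u <= v -> v - u <= d ->
  cell_mass alpha F u v <= Gamma (alpha + 1) * d `^ alpha.
Proof.
move=> uv vud; have d0 : 0 <= d by rewrite (le_trans _ vud)// subr_ge0.
rewrite -[leRHS]mulr1 ler_pM// ?mulr_ge0 ?powR_ge0 ?Gamma_ge0//.
rewrite ler_wpM2l ?Gamma_ge0// ge0_ler_powR ?nnegrE ?subr_ge0//.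
exact: ltW.
Qed.

Lemma cell_massS (u' u v v' : R) : u' <= u -> u <= v -> v <= v' ->
  cell_mass alpha F u v <= cell_mass alpha F u' v'.
Proof.
move=> uu uv vv; rewrite ler_pM ?mulr_ge0 ?powR_ge0 ?Gamma_ge0//.
  rewrite ler_wpM2l ?Gamma_ge0//.
  by apply: ge0_ler_powR; rewrite ?nnegrE ?(ltW alpha_gt0)//; lra.
by apply: rhoS; apply: subset_itv; rewrite bnd_simp.
Qed.

End CellMass.

(** * Joining subdivisions and cutting them at a point *)

Section Subdivision.
Context {R : realType} (alpha : R) (F : set R).
Hypothesis alpha_gt0 : 0 < alpha.

(** Trades the indexed sum for a recursion on the list: [node u v (x :: s) i.+1] computes to
    [node x v s i]. *)
Lemma mass_sum_cons u v x s : mass_sum alpha F u v (x :: s) =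
  cell_mass alpha F u x + mass_sum alpha F x v s.
Proof. by rewrite /mass_sum big_nat_recl. Qed.

Lemma mass_sum_ge0 u v s : 0 <= mass_sum alpha F u v s.
Proof. by rewrite /mass_sum sumr_ge0// => i _; exact: cell_mass_ge0. Qed.

Lemma subdivision_nil (d u v : R) : subdivision d u v [::] <-> u = v.
Proof.
split=> [[+ _]|->]; first exact: itv_partition_nil.
by split=> //; split=> /=.
Qed.

Lemma subdivision_cons (d u v x : R) s :
  subdivision d u v (x :: s) <->
  [/\ u < x, x - u <= d & subdivision d x v s].
Proof.
split=> [[[/= /andP[ux xs] xv] mesh]|[ux xud [[/= xs xv] mesh]]].
  by split=> //; [exact: (mesh 0%N)|split=> // i; exact: (mesh i.+1)].
by split=> [|[|i]]; [split=> //=; rewrite ux|by []|exact: mesh].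
Qed.

Lemma mass_sum_cat (u v w : R) s t : itv_partition u v s ->
  mass_sum alpha F u w (s ++ t) =
  mass_sum alpha F u v s + mass_sum alpha F v w t.
Proof.
elim: s u => [|x s IH] u.
  by move=> /itv_partition_nil ->; rewrite [X in _ = X + _]big_nil add0r.
move=> [/= /andP[_ xs] xv]; rewrite !mass_sum_cons (IH x)//.
by rewrite addrA.
Qed.

Lemma subdivision_cat (d u v w : R) s t : subdivision d u v s ->
  subdivision d v w t -> subdivision d u w (s ++ t).
Proof.
elim: s u => [|x s IH] u; first by move=> /subdivision_nil ->.
move=> /subdivision_cons[ux xud xs] vt; apply/subdivision_cons; split => //.
exact: IH.
Qed.

Lemma subdivision1 (d u v : R) : u < v -> v - u <= d ->
  subdivision d u v [:: v].
Proof. by move=> uv vud; apply/subdivision_cons; split=> //; apply/subdivision_nil. Qed.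

(* Only the cell containing [v] is cut, and both halves cost at most as much as
   the cell itself. *)
Lemma subdivision_split (d u v w : R) s : u < v -> v < w ->
  subdivision d u w s ->
  exists s1 s2, [/\ subdivision d u v s1, subdivision d v w s2 &
    mass_sum alpha F u v s1 + mass_sum alpha F v w s2 <=
    mass_sum alpha F u w s + Gamma (alpha + 1) * d `^ alpha].
Proof.
elim: s u => [|x s IH] u uv vw.
  by move=> /subdivision_nil uw; move: (lt_trans uv vw); rewrite uw ltxx.
move=> /subdivision_cons[ux xud xs].
have cost0 : 0 <= Gamma (alpha + 1) * d `^ alpha.
  by rewrite mulr_ge0 ?Gamma_ge0 ?powR_ge0.
have [xv|vx|xv] := ltgtP x v.
- have [s1 [s2 [vs1 ws2 le12]]] := IH x xv vw xs.
  exists (x :: s1), s2; split=> //; first by apply/subdivision_cons.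
  by rewrite !mass_sum_cons -!addrA lerD2l.
- exists [:: v], (x :: s); split.
  + by apply: subdivision1 => //; lra.
  + by apply/subdivision_cons; split=> //; lra.
  rewrite !mass_sum_cons [mass_sum _ _ _ _ [::]]big_nil addr0.
  (* The left half is charged to the uncut cell, the right half to the error term. *)
  rewrite [leRHS]addrAC addrA lerD2r lerD//.
    by rewrite cell_massS// ltW.
  by rewrite cell_mass_le// ?ltW//; lra.
- rewrite -xv in vw *; exists [:: x], s; split => //; first exact: subdivision1.
  rewrite !mass_sum_cons [mass_sum _ _ _ _ [::]]big_nil addr0.
  by rewrite lerDl.
Qed.

End Subdivision.

(** * Additivity of the mass and its smallness near endpoints *)

Section Mass.
Context {R : realType} (alpha : R) (F : set R).
Hypothesis alpha_gt0 : 0 < alpha.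
Local Open Scope ereal_scope.

Lemma coarse_mass_ge0 (u v d : R) : 0 <= coarse_mass alpha F u v d.
Proof.
by apply: le_ereal_inf_tmp => _ [s _ <-]; rewrite lee_fin mass_sum_ge0.
Qed.

Lemma coarse_mass_nonincreasing (u v : R) :
  {homo coarse_mass alpha F u v : d e / (d <= e)%R >-> e <= d}.
Proof.
move=> d e de; apply: ereal_inf_le_tmp => _ [s [us mesh] <-].
by exists s => //; split=> // i si; apply: le_trans (mesh i si) de.
Qed.

Lemma coarse_mass_le_cell (u v d : R) : (u < v)%R -> (v - u <= d)%R ->
  coarse_mass alpha F u v d <= (cell_mass alpha F u v)%:E.
Proof.
move=> uv vud; apply: ge_ereal_inf; exists (mass_sum alpha F u v [:: v])%:E.
  by exists [:: v] => //; exact: subdivision1.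
by rewrite mass_sum_cons [mass_sum _ _ _ _ _]big_nil addr0.
Qed.

(** Monotonicity in the mesh makes the [lim] in [mass] a genuine limit in the extended reals. *)
Lemma cvg_coarse_mass (u v : R) : (u < v)%R ->
  coarse_mass alpha F u v d @[d --> (0%R : R)^'+] --> mass alpha F u v.
Proof.
move=> uv; rewrite /mass uv; apply: nonincreasing_at_right_is_cvge.
by near=> e => d d' _ _; exact: coarse_mass_nonincreasing.
Unshelve. all: by end_near. Qed.

Lemma coarse_mass_le_mass (u v d : R) : (0 < d)%R -> (u < v)%R ->
  coarse_mass alpha F u v d <= mass alpha F u v.
Proof.
move=> d0 uv; apply: cvge_to_ge (cvg_coarse_mass _ _ uv) _.
near=> e; apply: coarse_mass_nonincreasing.
by near: e; exact: nbhs_right_le.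
Unshelve. all: by end_near. Qed.

(** Concatenating subdivisions of the two pieces gives a subdivision of the whole with the same mesh
    bound. *)
Lemma coarse_mass_subadditive (u v w d : R) :
  coarse_mass alpha F u w d <=
  coarse_mass alpha F u v d + coarse_mass alpha F v w d.
Proof.
(* Finiteness is needed to move this term across the inequality below. *)
have [->|vw_fin] := eqVneq (coarse_mass alpha F v w d) +oo.
  by rewrite addey ?leey// gt_eqF// (lt_le_trans _ (coarse_mass_ge0 _ _ _)).
have {}vw_fin : coarse_mass alpha F v w d \is a fin_num.
  by rewrite ge0_fin_numE ?coarse_mass_ge0// lt_neqAle vw_fin leey.
rewrite -leeBlDr//; apply: le_ereal_inf_tmp => _ [s us <-].
rewrite leeBlDr// -leeBlDl//; apply: le_ereal_inf_tmp => _ [t vt <-].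
rewrite leeBlDl// -EFinD; apply: ereal_inf_lbound.
exists (s ++ t); first exact: subdivision_cat us vt.
by case: us => us _; rewrite (mass_sum_cat _ _ _ _ _ _ _ us).
Qed.

Lemma coarse_mass_superadditive (u v w d : R) : (u < v)%R -> (v < w)%R ->
  coarse_mass alpha F u v d + coarse_mass alpha F v w d <=
  coarse_mass alpha F u w d + (Gamma (alpha + 1) * d `^ alpha)%:E.
Proof.
move=> uv vw; rewrite -leeBlDr//; apply: le_ereal_inf_tmp => _ [s us <-].
have [s1 [s2 [us1 vs2 le12]]] := subdivision_split _ F alpha_gt0 _ _ _ _ _ uv vw us.
rewrite leeBlDr//; apply: (@le_trans _ _
    ((mass_sum alpha F u v s1)%:E + (mass_sum alpha F v w s2)%:E)).
  by apply: leeD; apply: ereal_inf_lbound; [exists s1|exists s2].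
by rewrite -!EFinD lee_fin.
Qed.

Lemma mass_ge0 (u v : R) : 0 <= mass alpha F u v.
Proof.
have [uv|uv] := boolP (u < v)%R; last by rewrite /mass (negbTE uv).
apply: cvge_to_ge (cvg_coarse_mass _ _ uv) _.
by near=> d; exact: coarse_mass_ge0.
Unshelve. all: by end_near. Qed.

Lemma massxx (u : R) : mass alpha F u u = 0.
Proof. by rewrite /mass ltxx. Qed.

Lemma cvg_Gamma_powR :
  (Gamma (alpha + 1) * d `^ alpha)%R @[d --> (0%R : R)^'+] --> (0%R : R).
Proof.
rewrite -[X in _ --> X](mulr0 (Gamma (alpha + 1))).
exact: cvgM (cvg_cst _) (powR_cvg0 alpha_gt0).
Qed.

(** Sub- and superadditivity at mesh [d] differ only by the cost of one cut, which vanishes as [d]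
    tends to 0. *)
Lemma massD (u v w : R) : (u <= v)%R -> (v <= w)%R ->
  mass alpha F u w = mass alpha F u v + mass alpha F v w.
Proof.
rewrite le_eqVlt => /predU1P[<-|uv]; first by rewrite massxx add0e.
rewrite le_eqVlt => /predU1P[<-|vw]; first by rewrite massxx adde0.
have uw := lt_trans uv vw.
apply/eqP; rewrite eq_le; apply/andP; split.
  apply: cvge_to_le (cvg_coarse_mass _ _ uw) _.
  near=> d; apply: (le_trans (coarse_mass_subadditive u v w d)).
  by apply: leeD; apply: coarse_mass_le_mass.
(* The added 0 is the limit of the cutting error. *)
rewrite -[leRHS]adde0.
apply: (@lee_cvg_to _ (0%R : R)^'+ _ _
  (fun d => coarse_mass alpha F u v d + coarse_mass alpha F v w d)
  (fun d => coarse_mass alpha F u w d + (Gamma (alpha + 1) * d `^ alpha)%:E)).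
- apply: cvgeD (cvg_coarse_mass _ _ uv) (cvg_coarse_mass _ _ vw).
  by rewrite ge0_adde_def// inE mass_ge0.
- apply: cvgeD (cvg_coarse_mass _ _ uw) _.
    by rewrite ge0_adde_def// inE ?mass_ge0.
  by apply: cvg_EFin; [near=> d|exact: cvg_Gamma_powR].
- by near=> d; exact: coarse_mass_superadditive.
Unshelve. all: by end_near. Qed.

(* [mass] is a limit of [coarse_mass] and the coarse mass of a short interval is
   at most the cost of that single cell, so additivity leaves no room for mass
   concentrated at an endpoint. *)
Lemma mass_endpoint_small (u w e : R) : (u < w)%R ->
  mass alpha F u w \is a fin_num -> (0 < e)%R ->
  exists2 d, (0 < d)%R & forall v, (u < v)%R -> (v < w)%R ->
    ((v - u <= d)%R -> mass alpha F u v <= e%:E) /\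
    ((w - v <= d)%R -> mass alpha F v w <= e%:E).
Proof.
move=> uw uw_fin e0.
have e20 : (0 < e / 2)%R by rewrite divr_gt0.
(* Otherwise all coarse masses, hence their limit, would stay below the finite mass by [e / 2]. *)
have [d [d0 uw_d]] : exists d, (0 < d)%R /\
    mass alpha F u w <= coarse_mass alpha F u w d + (e / 2)%:E.
  apply: contrapT => /forallNP nd.
  have : mass alpha F u w <= mass alpha F u w - (e / 2)%:E.
    apply: cvge_to_le (cvg_coarse_mass _ _ uw) _; near=> d.
    rewrite leeBrDr// leNgt; apply/negP => /ltW lt_d; apply: (nd d).
    by split.
  by rewrite leNgt lteBlDr// lteDl// lte_fin e20.
(* A cell of length at most [c] costs at most [e / 2], and [c <= d] makes it an admissible
   subdivision at mesh [d]. *)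
have [c [c0 cd cost_c]] : exists c, [/\ (0 < c)%R, (c <= d)%R &
    (Gamma (alpha + 1) * c `^ alpha <= e / 2)%R].
  near (0%R : R)^'+ => c; exists c; split => //.
  - by near: c; exact: nbhs_right_le.
  - apply: le_trans (ler_norm _) _; near: c.
    by apply: (cvgr0Pnorm_le _).1 => //; exact: cvg_Gamma_powR.
exists c => // v uv vw.
have uvw := massD _ _ _ (ltW uv) (ltW vw).
have /andP[uv_fin vw_fin] : (mass alpha F u v \is a fin_num) &&
    (mass alpha F v w \is a fin_num) by rewrite -fin_numD -uvw.
have cell_small x y : (x < y)%R -> (y - x <= c)%R ->
    coarse_mass alpha F x y d <= (e / 2)%:E.
  move=> xy yxc; apply: le_trans (coarse_mass_le_cell _ _ _ xy (le_trans yxc cd)) _.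
  rewrite lee_fin (le_trans _ cost_c)//.
  by apply: cell_mass_le => //; exact: ltW.
have := le_trans uw_d (leeD (coarse_mass_subadditive u v w d) (lexx _)).
have le_uv := coarse_mass_le_mass _ _ _ d0 uv.
have le_vw := coarse_mass_le_mass _ _ _ d0 vw.
(* Bound the coarse mass of the short piece by [e / 2] and that of the other piece by its mass,
   which then cancels. *)
rewrite uvw => le_uvw; split=> small.
  have := le_trans le_uvw (leeD (leeD (cell_small _ _ uv small) le_vw) (lexx _)).
  rewrite -(fineK uv_fin) -(fineK vw_fin) -!EFinD !lee_fin; lra.
have := le_trans le_uvw (leeD (leeD le_uv (cell_small _ _ vw small)) (lexx _)).
rewrite -(fineK uv_fin) -(fineK vw_fin) -!EFinD !lee_fin; lra.
Unshelve. all: by end_near. Qed.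

End Mass.

(** * Continuity and strict growth of the staircase *)

Section Staircase.
Context {R : realType} (alpha : R) (F : set R) (a0 : R).
Hypothesis alpha_gt0 : 0 < alpha.
Hypothesis F_perfect : alpha_perfect alpha F a0.

Local Notation S := (staircase alpha F a0).
Local Notation s := (fun x => fine (staircase alpha F a0 x)).

Let S_fin x : S x \is a fin_num.
Proof. by case: F_perfect. Qed.

(* Here and below, [mass] and [staircase] are generalized to variables to keep
   unification from unfolding them down to the Gamma integral. *)
Lemma mass_fin_num x y : x <= y -> mass alpha F x y \is a fin_num.
Proof.
move=> xy; have := massD alpha F alpha_gt0; have := massxx alpha F.
move: S_fin; rewrite /staircase; move: (mass alpha F) => m S'_fin mxx mD.
(* Enlarge the interval to contain [a0]: cut there, its mass is a sum of two finite staircase values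
   up to sign. *)
have za : Num.min a0 x <= a0 by rewrite ge_min lexx.
have az : a0 <= Num.max a0 y by rewrite le_max lexx.
have : m (Num.min a0 x) (Num.max a0 y) \is a fin_num.
  rewrite (mD _ _ _ za az) fin_numD; apply/andP; split.
    move: za; rewrite le_eqVlt => /predU1P[->|za]; first by rewrite mxx.
    by have := S'_fin (Num.min a0 x); rewrite leNgt za/= fin_numN.
  by have := S'_fin (Num.max a0 y); rewrite az.
have zx : Num.min a0 x <= x by rewrite ge_min lexx orbT.
have yz : y <= Num.max a0 y by rewrite le_max lexx orbT.
rewrite (mD _ _ _ zx (le_trans xy yz)) (mD _ _ _ xy yz) !fin_numD.
by move=> /and3P[].
Qed.

(** Additivity eliminates the base point, wherever [a0] lies relative to [x] and [y]. *)
Lemma staircaseB x y : x <= y -> s y - s x = fine (mass alpha F x y).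
Proof.
move=> xy; have := mass_fin_num; have := massD alpha F alpha_gt0.
rewrite /staircase; move: (mass alpha F) => m mD m_fin.
have fine_mD u v w : u <= v -> v <= w ->
    fine (m u w) = fine (m u v) + fine (m v w).
  by move=> uv vw; rewrite (mD _ _ _ uv vw) fineD ?m_fin.
have [a0x|/ltW xa0] := leP a0 x.
  by rewrite (le_trans a0x xy) (fine_mD _ _ _ a0x xy) addrAC subrr add0r.
have [a0y|/ltW ya0] := leP a0 y.
  by rewrite fineN opprK (fine_mD _ _ _ xa0 a0y) [LHS]addrC.
by rewrite !fineN opprK (fine_mD _ _ _ xy ya0) addrC addrK.
Qed.

Lemma staircase_nondecreasing : {homo s : x y / x <= y}.
Proof.
by move=> x y xy; rewrite -subr_ge0 (staircaseB _ _ xy) fine_ge0 ?mass_ge0.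
Qed.

(** If the end values agreed, monotonicity would make the staircase constant on an open interval
    around [y], against perfectness. *)
Lemma staircase_lt x y z : x < y -> y < z -> F y -> s x < s z.
Proof.
case: F_perfect => _ _ _; have := staircase_nondecreasing; move: S_fin.
move: (staircase alpha F a0) => S' S'_fin S'_mono FE xy yz.
rewrite FE => /(_ x z); rewrite in_itv/= xy yz => /(_ isT) not_const.
rewrite lt_neqAle S'_mono ?andbT; last exact: ltW (lt_trans xy yz).
apply/eqP => sxz; apply: not_const; exists (S' x) => t.
rewrite in_itv/= => /andP[xt tz].
rewrite -(fineK (S'_fin t)) -(fineK (S'_fin x)); congr (_%:E).
by apply/eqP; rewrite eq_le {1}sxz !S'_mono// ltW.
Qed.

(** An increment at [x] is the mass of an interval with endpoint [x]; it is small by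
    [mass_endpoint_small], applied on the unit intervals to either side. *)
Lemma staircase_continuous : continuous s.
Proof.
move=> x; apply/cvgrPdist_le => e e0.
have xx1 : x < x + 1 by rewrite ltrDl.
have x1x : x - 1 < x by rewrite ltrBlDr ltrDl.
have := mass_endpoint_small _ _ alpha_gt0 (x - 1) x e x1x
  (mass_fin_num _ _ (ltW x1x)) e0.
have := mass_endpoint_small _ _ alpha_gt0 x (x + 1) e xx1
  (mass_fin_num _ _ (ltW xx1)) e0.
have := staircase_nondecreasing; have := staircaseB; have := mass_fin_num.
move: (mass alpha F) (staircase alpha F a0) => m S' m_fin S'B S'_mono.
move=> [d1 d10 right] [d2 d20 left].
near=> y.
have : `|x - y| < Num.min 1 (Num.min d1 d2).
  by near: y; apply: cvgr_dist_lt => //; rewrite !lt_min ltr01 d10.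
rewrite !lt_min => /and3P[xy1 xy2 xy3].
have [xy|yx|<-] := ltgtP x y; last by rewrite subrr normr0 ltW.
- rewrite distrC ger0_norm ?subr_ge0 ?(S'_mono _ _ (ltW xy))//.
  rewrite distrC ger0_norm ?subr_ge0 ?ltW// in xy1 xy2.
  rewrite (S'B _ _ (ltW xy)) -lee_fin (fineK (m_fin _ _ (ltW xy))).
  have [|+ _] := right y xy; first by lra.
  by apply; exact: ltW.
- rewrite ger0_norm ?subr_ge0 ?(S'_mono _ _ (ltW yx))//.
  rewrite ger0_norm ?subr_ge0 ?ltW// in xy1 xy3.
  rewrite (S'B _ _ (ltW yx)) -lee_fin (fineK (m_fin _ _ (ltW yx))).
  have [|//|_ +] := left y; first by lra.
  by apply; exact: ltW.
Unshelve. all: by end_near. Qed.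

(** Without isolated points, every point of [F] is a limit point of [F]. Properness makes F-limits
    unique. *)
Lemma Fnbhs_proper x : F x -> ProperFilter (Fnbhs F x).
Proof.
move=> Fx; apply: Build_ProperFilter_ex => A /= xA.
have : closure F x by exact: subset_closure.
rewrite closure_isolated_limit_point; case: F_perfect => _ _ -> _.
rewrite set0U => /(_ (fun y => y != x -> F y -> A y))[//|y [yx Fy]] /(_ yx Fy).
by exists y.
Qed.

(* Two points of [F] with equal staircase values bound a gap of [F], so on each
   side of [x] at most one [y] violates the inequality. *)
Lemma staircase_neq_near x : F x -> \forall y \near Fnbhs F x, s y != s x.
Proof.
move=> Fx; have := staircase_lt; move: (staircase alpha F a0) => S' S'_lt.
have [d1 d10 right] : exists2 d, 0 < d &
    forall y, F y -> x < y -> y < x + d -> fine (S' y) != fine (S' x).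
  (* If such a [z] exists, [staircase_lt] forbids points of [F] strictly between [x] and [z]; if
     none does, any radius works. *)
  have [[z [xz sz]]|none] := pselect (exists z, [/\ x < z &
      F z /\ fine (S' z) = fine (S' x)]).
    exists (z - x) => [|y Fy xy yz]; first by rewrite subr_gt0.
    rewrite addrC subrK in yz.
    by have := S'_lt _ _ _ xy yz Fy; rewrite (proj2 sz) ltxx.
  exists 1 => // y Fy xy _; apply/eqP => syx; apply: none.
  by exists y.
have [d2 d20 left] : exists2 d, 0 < d &
    forall y, F y -> y < x -> x - d < y -> fine (S' y) != fine (S' x).
  have [[z [zx sz]]|none] := pselect (exists z, [/\ z < x &
      F z /\ fine (S' z) = fine (S' x)]).
    exists (x - z) => [|y Fy yx zy]; first by rewrite subr_gt0.
    rewrite opprB addrC subrK in zy.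
    by have := S'_lt _ _ _ zy yx Fy; rewrite (proj2 sz) ltxx.
  exists 1 => // y Fy yx _; apply/eqP => syx; apply: none.
  by exists y.
rewrite near_withinE; near=> y => Fy.
have : `|x - y| < Num.min d1 d2.
  near: y; apply: nbhs_dnbhs; apply: (@cvgr_dist_lt _ _ _ (nbhs x) _ id) => //.
  by rewrite lt_min d10.
rewrite lt_min => /andP[xy1 xy2].
have [xy|yx|xy] := ltgtP x y.
- by apply: right => //; move: xy1; rewrite distrC gtr0_norm ?subr_gt0//; lra.
- by apply: left => //; move: xy2; rewrite gtr0_norm ?subr_gt0//; lra.
- have : y != x by near: y; exact: nbhs_dnbhs_neq.
  by rewrite xy eqxx.
Unshelve. all: by end_near. Qed.

End Staircase.

(** * Calculus rules for the derivative along [F] *)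

#[local] Instance Fnbhs_filter {R : realType} (F : set R) (x : R) :
  Filter (Fnbhs F x).
Proof. exact: within_filter. Qed.

Section FalphaDerivative.
Context {R : realType} (alpha : R) (F : set R) (a0 : R).
Hypothesis alpha_gt0 : 0 < alpha.
Hypothesis F_perfect : alpha_perfect alpha F a0.
Variable x : R.
Hypothesis Fx : F x.

Local Notation quotient f := (Fquotient alpha F a0 f x).

Let Fnbhs_proper_x : ProperFilter (Fnbhs F x) :=
  Fnbhs_proper _ _ _ F_perfect _ Fx.
#[local] Existing Instance Fnbhs_proper_x.

Lemma cvg_Fquotient (f : R -> R) : Fderivable alpha F a0 f x ->
  quotient f y @[y --> Fnbhs F x] --> Fderive alpha F a0 f x.
Proof. by rewrite /Fderive mem_set. Qed.

Lemma Fderivable_cvg (f : R -> R) (l : R) :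
  quotient f y @[y --> Fnbhs F x] --> l -> Fderivable alpha F a0 f x.
Proof. by move=> fl; apply/cvg_ex; exists l. Qed.

Lemma Fderive_cvg (f : R -> R) (l : R) :
  quotient f y @[y --> Fnbhs F x] --> l -> Fderive alpha F a0 f x = l.
Proof. by move=> fl; rewrite /Fderive mem_set//; exact: cvg_lim. Qed.

Lemma cvg_quotientB (f g : R -> R) (l m : R) :
  quotient f y @[y --> Fnbhs F x] --> l ->
  quotient g y @[y --> Fnbhs F x] --> m ->
  quotient (fun y => f y - g y) y @[y --> Fnbhs F x] --> l - m.
Proof.
move=> fl gm.
have fgB : quotient f y - quotient g y @[y --> Fnbhs F x] --> l - m.
  exact: cvgB fl gm.
apply: cvg_trans fgB; apply: near_eq_cvg; near=> y.
by rewrite /Fquotient -mulrBl; congr (_ * _); ring.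
Unshelve. all: by end_near. Qed.

(** Near [x] in [F] the denominator is nonzero, so [f y] is the quotient times the staircase
    increment, plus [f x]; the increment tends to 0 by continuity. *)
Lemma Fderivable_Fcontinuous_at (f : R -> R) : Fderivable alpha F a0 f x ->
  f y @[y --> Fnbhs F x] --> f x.
Proof.
move=> /cvg_Fquotient fl.
have S_cvg : fine (staircase alpha F a0 y) @[y --> Fnbhs F x] -->
    fine (staircase alpha F a0 x).
  apply: cvg_trans (staircase_continuous _ _ _ alpha_gt0 F_perfect x).
  apply: cvg_app; apply: cvg_trans (cvg_within _) _.
  exact: cvg_within.
have prod_cvg : quotient f y *
      (fine (staircase alpha F a0 y) - fine (staircase alpha F a0 x)) + f x
    @[y --> Fnbhs F x] --> Fderive alpha F a0 f x *
      (fine (staircase alpha F a0 x) - fine (staircase alpha F a0 x)) + f x.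
  exact: cvgD (cvgM fl (cvgB S_cvg (cvg_cst _))) (cvg_cst _).
rewrite subrr mulr0 add0r in prod_cvg.
apply: cvg_trans prod_cvg; apply: near_eq_cvg.
have := staircase_neq_near _ _ _ alpha_gt0 F_perfect _ Fx.
rewrite /Fquotient; move: (staircase alpha F a0) => S' neq.
near=> y; rewrite divfK ?subrK// subr_eq0.
by near: y.
Unshelve. all: by end_near. Qed.

(** The quotient of the product is exactly [quotient f y * g x + f y * quotient g y], even where the
    denominator vanishes; F-continuity of [f] handles the factor [f y]. *)
Lemma cvg_quotientM (f g : R -> R) :
  Fderivable alpha F a0 f x -> Fderivable alpha F a0 g x ->
  quotient (fun y => f y * g y) y @[y --> Fnbhs F x] -->
  Fderive alpha F a0 f x * g x + f x * Fderive alpha F a0 g x.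
Proof.
move=> df dg; have fx := Fderivable_Fcontinuous_at _ df.
have fgM : quotient f y * g x + f y * quotient g y @[y --> Fnbhs F x] -->
    Fderive alpha F a0 f x * g x + f x * Fderive alpha F a0 g x.
  apply: cvgD; apply: cvgM => //; [exact: cvg_Fquotient|exact: cvg_cst|].
  exact: cvg_Fquotient.
apply: cvg_trans fgM; apply: near_eq_cvg; near=> y.
rewrite /Fquotient mulrA [_ / _ * _]mulrAC -mulrDl; congr (_ * _); ring.
Unshelve. all: by end_near. Qed.

Lemma FderivableB (f g : R -> R) :
  Fderivable alpha F a0 f x -> Fderivable alpha F a0 g x ->
  Fderivable alpha F a0 (fun y => f y - g y) x.
Proof.
move=> /cvg_Fquotient df /cvg_Fquotient dg.
exact: Fderivable_cvg (cvg_quotientB _ _ _ _ df dg).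
Qed.

Lemma FderiveB (f g : R -> R) :
  Fderivable alpha F a0 f x -> Fderivable alpha F a0 g x ->
  Fderive alpha F a0 (fun y => f y - g y) x =
  Fderive alpha F a0 f x - Fderive alpha F a0 g x.
Proof.
move=> /cvg_Fquotient df /cvg_Fquotient dg.
exact: Fderive_cvg (cvg_quotientB _ _ _ _ df dg).
Qed.

Lemma FderiveM (f g : R -> R) :
  Fderivable alpha F a0 f x -> Fderivable alpha F a0 g x ->
  Fderive alpha F a0 (fun y => f y * g y) x =
  Fderive alpha F a0 f x * g x + f x * Fderive alpha F a0 g x.
Proof. by move=> df dg; exact: Fderive_cvg (cvg_quotientM _ _ df dg). Qed.

End FalphaDerivative.

Theorem theorem4 (R : realType) (alpha : R) (F : set R) (a0 a b : R)
    (P Q T : R -> R) :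
  0 < alpha -> alpha <= 1 -> a < b ->
  alpha_perfect alpha F a0 ->
  Cn alpha F a0 a b 2 P ->
  Cn alpha F a0 a b 1 Q ->
  Fcontinuous F a b T ->
  (forall x, x \in F -> x \in `]a, b[ ->
     Fderiven alpha F a0 2 P x - Fderive alpha F a0 Q x + T x = 0) ->
  exact_equation alpha F a0 a b P Q T.
Proof.
move=> alpha_gt0 _ _ F_perfect P2 Q1 _ PQT.
pose D := Fderive alpha F a0.
exists (fun y => Q y - D P y).
have dg x : x \in F -> x \in `]a, b[ ->
    Fderivable alpha F a0 (fun y => Q y - D P y) x.
  move=> xF xab; apply: FderivableB; first exact: set_mem.
    exact: (Q1 0%N).
  exact: (P2 1%N).
split=> [[|//] _|f f2 x xF xab]; first exact: dg.
have Fx := set_mem xF.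
have dP := P2 0%N isT x xF xab; have dDP := P2 1%N isT x xF xab.
have df := f2 0%N isT x xF xab; have dDf := f2 1%N isT x xF xab.
have DM := FderiveM _ _ _ alpha_gt0 F_perfect _ Fx.
rewrite (DM _ _ dP dDf) (DM _ _ (dg x xF xab) df).
rewrite (FderiveB _ _ _ F_perfect _ Fx _ _ (Q1 0%N isT x xF xab) dDP).
have := PQT x xF xab; rewrite /Fderiven /= -/D => PQTx.
(* The hypothesis, solved for [T x], is the coefficient of [f x] left by the two product rules; the
   terms [D P x * D f x] cancel. *)
have -> : T x = D Q x - D (D P) x by rewrite -[LHS]subr0 -PQTx; ring.
by ring.
Qed.
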